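(* Given a finite set $G_0\subset G$ and a non-empty open set $V\subset M$, there exists a non-empty open set $\Delta\subset V$ such that for each $g\in G_0$ either $\beta_g|_\Delta=\mathrm{id}_\Delta$ or $\beta_g(\Delta)\cap\Delta=\emptyset$. In particular, $G_0=\tilde D\cup D_0$ with $$\beta_g|_\Delta=\mathrm{id}_\Delta\ \text{ for } g\in\tilde D,\qquad \beta_g(\Delta)\cap\Delta=\emptyset\ \text{ for } g\in D_0=G_0\setminus\tilde D .$$ Moreover, if $G_0$ is closed under inverses, then $D_0$ and $\tilde D$ are closed under inverses.
   Context: Setting. $H$ is a Hilbert space, $\mathcal A\subset B(H)$ is a unital $C^*$-subalgebra with $1_{\mathcal A}=I$, $G$ is a discrete group, $U:G\to B(H)$, $g\mapsto U_g$, is a unitary representation, and $\mathcal Z$ is a central $C^*$-subalgebra of $\mathcal A$ with $1_{\mathcal A}\in\mathcal Z$. It is assumed that for every $g\in G$, $\alpha_g(a)=U_gaU_g^*$ defines a $*$-automorphism of both $\mathcal A$ and $\mathcal Z$. $M$ is the compact Hausdorff maximal ideal (character) space of $\mathcal Z$, and $\mathcal Z$ is identified with $C(M)$ by the Gelfand transform. For $g\in G$, $\beta_g:M\to M$ is the homeomorphism with $z(\beta_g(m))=(\alpha_g(z))(m)$ for $z\in\mathcal Z$, $m\in M$. *)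

(* Defs.v *)
From HB Require Import structures.
From mathcomp Require Import all_boot all_order all_algebra.
From mathcomp Require Import all_classical all_reals all_analysis.
From mathcomp Require Import sesquilinear complex.

Set Implicit Arguments.
Unset Strict Implicit.
Unset Printing Implicit Defensive.

Import Order.TTheory GRing.Theory Num.Theory.
Import numFieldNormedType.Exports.

Local Open Scope classical_set_scope.
Local Open Scope ring_scope.

(* The form [inner] is linear in its first argument and conjugate-linear in
   its second one. *)
Record hilbertType (R : realType) := HilbertType {
  hilbert_sort :> completeNormedModType R[i];
  inner : {dot hilbert_sort for (@Num.conj R[i])};
  hilbert_normE : forall x : hilbert_sort, `|x| ^+ 2 = inner x x }.

Section Operators.
Context {R : realType} {H : hilbertType R}.
Implicit Types (S : set (H -> H)) (T a b : H -> H).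

(* Operators are functions H -> H, with the pointwise linear structure of the
   library on such functions; the product is composition. *)
Definition bounded_op : set (H -> H) :=
  [set T | linear T /\ exists M : R[i], forall x, `|T x| <= M * `|x|].

(* The norm of H takes its values among the nonnegative real elements of R[i]. *)
Definition op_norm T : R :=
  sup [set complex.Re `|T x| | x in [set x : H | `|x| <= 1]].

Definition is_adjoint T T' : Prop :=
  forall x y, inner H (T x) y = inner H x (T' y).

(* A bounded operator has exactly one adjoint; the value is the junk operator 0
   on functions having none. *)
Definition adj T : H -> H := xget 0 [set T' | is_adjoint T T'].

(* Norm-closed *-subalgebra of B(H). *)
Record Cstar_subalgebra S : Prop := CstarSubalgebra {
  cstar_bounded : S `<=` bounded_op;
  cstar0 : S 0;
  cstarD : forall a b, S a -> S b -> S (a + b);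
  cstarZ : forall (k : R[i]) a, S a -> S (k *: a);
  cstarM : forall a b, S a -> S b -> S (a \o b);
  cstar_adj : forall a, S a -> S (adj a);
  cstar_closed : forall T, bounded_op T ->
    (forall e : R, 0 < e -> exists2 a, S a & op_norm (T - a) < e) -> S T }.

Definition unital_Cstar_subalgebra S : Prop := Cstar_subalgebra S /\ S idfun.

Definition central_in (A Z : set (H -> H)) : Prop :=
  Z `<=` A /\ forall z a, Z z -> A a -> z \o a = a \o z.

Record star_automorphism S (f : (H -> H) -> (H -> H)) : Prop :=
  StarAutomorphism {
  saut_bij : set_bij S S f;
  sautD : forall a b, S a -> S b -> f (a + b) = f a + f b;
  sautZ : forall (k : R[i]) a, S a -> f (k *: a) = k *: f a;
  sautM : forall a b, S a -> S b -> f (a \o b) = f a \o f b;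
  saut_adj : forall a, S a -> f (adj a) = adj (f a) }.

Definition unitary_op T : Prop :=
  [/\ bounded_op T, T \o adj T = idfun & adj T \o T = idfun].

Record unitary_representation (G : groupType) (U : G -> H -> H) : Prop :=
  UnitaryRepresentation {
  urep_unitary : forall g, unitary_op (U g);
  urep1 : U 1%g = idfun;
  urepM : forall g h, U (g * h)%g = U g \o U h }.

Definition alpha (G : groupType) (U : G -> H -> H) (g : G) a : H -> H :=
  U g \o a \o adj (U g).

(* Nonzero multiplicative linear functionals on Z. The subtype [set_type Z] of
   elements of Z carries no algebraic structure, so the operations are read off
   in H -> H: [c] below is the element of Z whose underlying operator is the
   sum, multiple or product. *)
Record is_character (Z : set (H -> H)) (phi : Z -> R[i]) : Prop :=
  IsCharacter {
  characterD : forall a b c : Z,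
    set_val c = set_val a + set_val b -> phi c = phi a + phi b;
  characterZ : forall (k : R[i]) (a c : Z),
    set_val c = k *: set_val a -> phi c = k * phi a;
  characterM : forall a b c : Z,
    set_val c = set_val a \o set_val b -> phi c = phi a * phi b;
  character_neq0 : exists a : Z, phi a != 0 }.

(* The topology on characters is that of pointwise convergence on Z (weak-*
   topology): [{ptws Z -> _}] is the product topology, and the subtype
   [set_type] carries the induced one. *)
Definition characters (Z : set (H -> H)) : set {ptws Z -> R[i]^o} :=
  [set phi | is_character phi].
Arguments characters Z : clear implicits.

Definition character_space (Z : set (H -> H)) : topologicalType :=
  set_type (characters Z).

Definition gelfand (Z : set (H -> H)) (z : Z) (m : character_space Z) : R[i] :=
  (set_val m : Z -> R[i]) z.

Section Beta.
Variables (G : groupType) (U : G -> H -> H) (Z : set (H -> H)).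
Hypothesis autZ : forall g, star_automorphism Z (alpha U g).

Lemma alpha_in g (z : Z) : alpha U g (set_val z) \in Z.
Proof.
by apply/mem_set; case: (saut_bij (autZ g)) => fZ _ _; apply: fZ; exact: set_valP.
Qed.

Definition alphaZ g (z : Z) : Z := exist _ (alpha U g (set_val z)) (alpha_in g z).

Lemma beta_in g (m : character_space Z) :
  (fun z : Z => gelfand (alphaZ g z) m : R[i]^o) \in characters Z.
Proof.
apply/mem_set; have /= mP := set_valP m.
have inZ (z : Z) : Z (set_val z) by exact: set_valP.
split=> [a b e h|k a e h|a b e h|].
- apply: (characterD mP); rewrite [LHS]/(alpha U g (set_val e)) h.
  exact: (sautD (autZ g)).
- apply: (characterZ mP); rewrite [LHS]/(alpha U g (set_val e)) h.
  exact: (sautZ (autZ g)).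
- apply: (characterM mP); rewrite [LHS]/(alpha U g (set_val e)) h.
  exact: (sautM (autZ g)).
have [a a0] := character_neq0 mP.
have [_ _ /(_ _ (inZ a)) [b Zb ab]] := saut_bij (autZ g).
exists (exist _ b (mem_set Zb)); rewrite /gelfand /=.
suff -> : alphaZ g (exist _ b (mem_set Zb)) = a by [].
by apply: val_inj; rewrite /= set_valE.
Qed.

(* beta_g, as the transpose of alpha_g on characters: the unique map
   satisfying [betaE]. *)
Definition beta g (m : character_space Z) : character_space Z :=
  exist (fun phi => phi \in characters Z) _ (beta_in g m).

Lemma betaE g (z : Z) (m : character_space Z) :
  gelfand z (beta g m) = gelfand (alphaZ g z) m.
Proof. by rewrite /gelfand set_valE. Qed.

End Beta.

End Operators.

Definition inverse_closed (G : groupType) (S : set G) : Prop :=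
  forall g, S g -> S (g^-1)%g.

(* Main.v *)
Require Import Defs.
From HB Require Import structures.
From mathcomp Require Import all_boot all_order all_algebra.
From mathcomp Require Import all_classical all_reals all_analysis.
From mathcomp Require Import complex.

(** The existence of Delta is a fact about continuous self-maps of a Hausdorff
    space. If a map f moves some point m of V, then m and f m have disjoint open
    neighbourhoods C and B, and the points of V lying in C and sent into B form
    a nonempty open set disjoint from its image; otherwise f is the identity on
    V. Both alternatives pass to smaller sets, so finitely many maps can be
    treated one after the other, shrinking the open set each time
    ([finite_hausdorff_fixed_or_moved]).

    This applies to the maps beta_g on the characters of Z: characters are
    separated by the evaluations [gelfand z], which are continuous, and an
    evaluation composed with beta_g is again an evaluation, at alpha_g z
    ([character_space_hausdorff], [beta_continuous]).

    Closure under inverses holds for the partition that puts into Dt all the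
    g in G0 fixing Delta pointwise. Since U_g is unitary, its adjoint is
    U_(g^-1), so alpha_(g^-1) inverts alpha_g and beta_(g^-1) inverts beta_g;
    a map and its inverse have the same fixed points ([beta_inv_fixed]). *)

Local Open Scope classical_set_scope.

(** The open set only has to be shrunk around a single moved point; when there
    is none, V itself is fixed pointwise. *)
Lemma hausdorff_fixed_or_moved (X : topologicalType) (f : X -> X)
    (X_T2 : hausdorff_space X) (f_cont : continuous f)
    (V : set X) (V_open : open V) (V_neq0 : V !=set0) :
  exists Delta : set X, [/\ open Delta, Delta !=set0, Delta `<=` V &
    (forall m, Delta m -> f m = m) \/ (f @` Delta) `&` Delta = set0].
Proof.
have [fV|/existsNP[m /not_implyP[Vm /eqP fm_neq]]] :=
  pselect (forall m, V m -> f m = m).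
  by exists V; split=> //; left.
move: X_T2; rewrite open_hausdorff => /(_ _ _ fm_neq).
move=> [[B C]] /= [/set_mem Bfm /set_mem Cm] [B_open C_open BC0].
exists (V `&` C `&` f @^-1` B); split.
- by apply: openI; [exact: openI|move/continuousP : f_cont; exact].
- by exists m.
- by move=> x [[]].
- right; apply/seteqP; split=> // _ [[x [_ Bfx] <-] [[_ Cfx] _]].
  by rewrite -(eqP BC0).
Qed.

(** Induction on F: an alternative already decided for earlier maps on a larger
    open set remains true on every subset of it. *)
Lemma finite_hausdorff_fixed_or_moved (I : choiceType) (X : topologicalType)
    (f : I -> X -> X) (X_T2 : hausdorff_space X)
    (f_cont : forall i, continuous (f i)) (F : set I) (F_finite : finite_set F)
    (V : set X) (V_open : open V) (V_neq0 : V !=set0) :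
  exists Delta : set X, [/\ open Delta, Delta !=set0, Delta `<=` V &
    forall i, F i ->
      (forall m, Delta m -> f i m = m) \/ (f i @` Delta) `&` Delta = set0].
Proof.
have /finite_seqP[s ->] := F_finite.
elim: s => [|i s [W [W_open W_neq0 WV Ws]]]; first by exists V; split.
have [D [D_open D_neq0 DW Di]] :=
  hausdorff_fixed_or_moved _ (f i) X_T2 (f_cont i) W W_open W_neq0.
exists D; split=> //; first exact: subset_trans WV.
move=> j /=; rewrite inE => /orP[/eqP ->//|js].
have [Wj|Wj] := Ws j js; [left=> m /DW /Wj//|right].
by apply: subsetI_eq0 Wj => //; exact: image_subset.
Qed.

Section CharacterSpace.
Context {R : realType} {H : hilbertType R}.
Implicit Types Z : set (H -> H).

Lemma gelfand_inj Z (m n : character_space Z) :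
  (forall z, gelfand z m = gelfand z n) -> m = n.
Proof. by move=> mn; apply: val_inj; apply/funext => z; exact: mn. Qed.

Lemma gelfand_continuous {Z} (z : Z) :
  continuous (gelfand z : character_space Z -> R[i]^o).
Proof.
move=> m.
apply: (@continuous_comp (character_space Z) {ptws Z -> R[i]^o} R[i]^o
  set_val (proj z)).
  exact: initial_continuous.
exact: proj_continuous.
Qed.

(** If the neighbourhoods of two characters always meet, so do those of their
    values at each z, because evaluation is continuous; the scalars being
    Hausdorff, the two characters agree at every z. *)
Lemma character_space_hausdorff Z : hausdorff_space (character_space Z).
Proof.
move=> m n mn; apply: gelfand_inj => z.
apply: (@norm_hausdorff _ R[i]^o) => B C mB nC.
have [l [Bl Cl]] :=
  mn _ _ (gelfand_continuous z _ _ mB) (gelfand_continuous z _ _ nC).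
by exists (gelfand z l).
Qed.

Section Transpose.
Context {G : groupType} {U : G -> H -> H} {Z : set (H -> H)}.
Context (autZ : forall g, star_automorphism Z (alpha U g)).

(** In the topology of pointwise convergence it suffices that each z evaluated
    at beta_g m be continuous in m, and this is the evaluation at alpha_g z. *)
Lemma beta_continuous g : continuous (beta autZ g).
Proof.
apply: continuous_comp_initial => m.
apply/cvg_sup => [|z]; first exact/fmap_filter/nbhs_filter.
move: m; apply: (@continuous_comp_initial _ _ _ (fun phi : Z -> R[i]^o => phi z)).
exact: (gelfand_continuous (alphaZ autZ g z)).
Qed.

Context (U_rep : unitary_representation U).

Lemma urep_invK g : cancel (U g) (U g^-1%g).
Proof.
by move=> x; rewrite -[LHS]/((U g^-1%g \o U g) x) -(urepM U_rep) mulVg urep1.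
Qed.

(** The adjoint is a left inverse of the unitary U_g, whose two-sided inverse is
    U_(g^-1). *)
Lemma adj_urep g : adj (U g) = U g^-1%g.
Proof.
have [_ _ adjK] := urep_unitary U_rep g; apply/funext => x.
have UV : U g (U g^-1%g x) = x by have := urep_invK g^-1%g x; rewrite invgK.
by rewrite -{1}UV -[LHS]/((adj (U g) \o U g) _) adjK.
Qed.

Lemma alpha_invK g : cancel (alpha U g) (alpha U g^-1%g).
Proof.
by move=> a; apply/funext => x; rewrite /alpha /= !adj_urep invgK !urep_invK.
Qed.

Lemma beta_invK g : cancel (beta autZ g^-1%g) (beta autZ g).
Proof.
move=> m; apply: gelfand_inj => z; rewrite !betaE; congr gelfand.
by apply: val_inj; exact: alpha_invK.
Qed.

(** This makes the set of g whose beta_g is the identity on Delta closed under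
    inverses, hence also its complement in an inverse-closed set. *)
Lemma beta_inv_fixed g (m : character_space Z) :
  beta autZ g m = m -> beta autZ g^-1%g m = m.
Proof. by move=> gm; have := beta_invK g^-1%g m; rewrite invgK gm. Qed.

End Transpose.
End CharacterSpace.

Theorem lemma2 (R : realType) (H : hilbertType R)
  (A : set (H -> H)) (A_Cstar : unital_Cstar_subalgebra A)
  (G : groupType) (U : G -> H -> H) (U_rep : unitary_representation U)
  (Z : set (H -> H)) (Z_Cstar : unital_Cstar_subalgebra Z)
  (Z_central : central_in A Z)
  (autA : forall g : G, star_automorphism A (alpha U g))
  (autZ : forall g : G, star_automorphism Z (alpha U g))
  (G0 : set G) (G0_finite : finite_set G0)
  (V : set (character_space Z)) (V_open : open V) (V_neq0 : V !=set0) :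
  exists Delta : set (character_space Z),
    [/\ open Delta, Delta !=set0, Delta `<=` V,
        forall g, G0 g ->
          (forall m, Delta m -> beta autZ g m = m) \/
          (beta autZ g @` Delta) `&` Delta = set0 &
        exists Dt D0 : set G,
          [/\ G0 = Dt `|` D0, D0 = G0 `\` Dt,
              forall g, Dt g -> forall m, Delta m -> beta autZ g m = m,
              forall g, D0 g -> (beta autZ g @` Delta) `&` Delta = set0 &
              inverse_closed G0 -> inverse_closed D0 /\ inverse_closed Dt]].
Proof.
have [Delta [Delta_open Delta_neq0 DeltaV G0_dich]] :=
  finite_hausdorff_fixed_or_moved _ _ _ (character_space_hausdorff Z)
    (beta_continuous autZ) G0 G0_finite V V_open V_neq0.
exists Delta; split=> //.
pose Fix := [set g | forall m, Delta m -> beta autZ g m = m].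
have FixV g : Fix g -> Fix g^-1%g.
  by move=> gFix m Dm; apply: (beta_inv_fixed autZ U_rep); exact: gFix.
exists (G0 `&` Fix), (G0 `\` (G0 `&` Fix)); split=> //.
- by rewrite setDUK//; apply: subIsetl.
- by move=> g [].
- by move=> g [G0g /not_andP[//|gNFix]]; have [] := G0_dich g G0g.
- move=> G0V; split=> g [G0g gP]; split; [exact: G0V| |exact: G0V|exact: FixV].
  (* If g^-1 fixed Delta pointwise, then so would its inverse g. *)
  by move=> [_ /FixV]; rewrite invgK => gFix; exact: gP.
Qed.
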